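(* Let $G\cong\mathbb{Z}_2^d$ be an elementary abelian $2$-group of order $n=2^d$, and let $k$ be an integer with $1\le k\le n-1$. Let $S$ be a uniformly random $k$-element subset of $G\setminus\{1\}$. Then $$p\Big(n,k,\frac{n-2}{2}\Big)-\frac{k}{n-1}\;\le\;\Pr\big(\operatorname{diam}(\operatorname{Cay}(G,S))>2\big)\;\le\;(n-1)\,p\Big(n,k,\frac{n-2}{2}\Big).$$
   Context: For a finite group $G$ (with identity element denoted $1$) and a subset $S\subseteq G\setminus\{1\}$, the Cayley digraph $\operatorname{Cay}(G,S)$ has vertex set $G$ and arc set $\{(g,gs): g\in G, s\in S\}$. The distance from $g$ to $h$ is the length of the shortest directed path from $g$ to $h$ (infinite if there is none). The diameter $\operatorname{diam}(\operatorname{Cay}(G,S))$ is the smallest integer $m$ such that for every ordered pair $(g,h)$ the distance from $g$ to $h$ is at most $m$ (and is $\infty$ if no such $m$ exists; then it counts as $>2$). The function $p$ is defined by $$p(n,k,t)=\sum_{i=0}^{t}(-1)^i\binom{t}{i}\frac{(k)_{2i}}{(n-1)_{2i}},$$ where $(r)_\ell=r(r-1)\cdots(r-\ell+1)$ is the descending factorial with $(r)_0=1$. *)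

(* Defs.v *)
From mathcomp Require Import all_boot all_order all_algebra all_fingroup all_solvable.
From mathcomp Require Import boolp.

Set Implicit Arguments.
Unset Strict Implicit.
Unset Printing Implicit Defensive.

Import Order.TTheory GRing.Theory Num.Theory.
Local Open Scope ring_scope.

(* Extended naturals are represented by [option nat], with [None] as infinity. *)
Definition least (P : pred nat) : option nat :=
  if pselect (exists m, P m) is left exP then Some (ex_minn exP) else None.

Definition le_enat (x : option nat) (m : nat) : bool :=
  if x is Some l then (l <= m)%N else false.

Section Digraph.
Variables (T : finType) (arc : rel T).

(* A directed path of length [m] has [m] arcs and pairwise distinct vertices. *)
Definition has_dipath (x y : T) (m : nat) : bool :=
  [exists p : m.-tuple T, [&& path arc x p, uniq (x :: p) & last x p == y]].

Definition distance (x y : T) : option nat := least (has_dipath x y).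

Definition diameter : option nat :=
  least (fun m => [forall x, forall y, le_enat (distance x y) m]).

End Digraph.

Definition cayley (gT : finGroupType) (S : {set gT}) : rel gT :=
  fun g h => [exists s in S, h == (g * s)%g].

(* The finite group is a whole [finGroupType], so that it is the vertex set. *)
Definition connection_sets (gT : finGroupType) (k : nat) : {set {set gT}} :=
  [set S : {set gT} | S \subset [set: gT]^#%g & #|S| == k].

Definition uniform_prob (T : finType) (Omega : {set T}) (E : pred T) : rat :=
  #|[set x in Omega | E x]|%:R / #|Omega|%:R.

(* Only used with [2 * t <= n - 1], where no denominator vanishes. *)
Definition pfun (n k t : nat) : rat :=
  \sum_(0 <= i < t.+1)
    (-1) ^+ i * 'C(t, i)%:R * ((k ^_ (2 * i))%N%:R / ((n - 1) ^_ (2 * i))%N%:R).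

(* Main.v *)
(** In an elementary abelian 2-group, a vertex [z != 1] is a product of two
    elements of [S] iff [S] contains one of the [(n - 2) / 2] cosets of
    [{1, z}] other than [{1, z}] itself.  These cosets are disjoint pairs, so
    inclusion-exclusion gives [pfun n k ((n - 2) / 2)] as the probability that
    [z] is not such a product.  The diameter exceeds 2 iff some [z != 1] lies
    neither in [S] nor in [S * S]: the upper bound is the union bound over [z],
    and the lower bound uses one [z], discarding the event [z \in S] of
    probability [k / (n - 1)]. *)

Require Import Defs.
From mathcomp Require Import all_boot all_order all_algebra all_fingroup all_solvable.

Set Implicit Arguments.
Unset Strict Implicit.
Unset Printing Implicit Defensive.

Import Order.TTheory GRing.Theory Num.Theory.
Local Open Scope ring_scope.

(** * Counting [k]-subsets that contain a given set *)

(** Double counting of a [k]-subset together with an ordered choice of [w] of its elements: either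
    the ordered choice or the subset comes first. *)
Lemma bin_sub_ffact (N k w : nat) :
  (w <= k)%N -> ('C(N - w, k - w) * N ^_ w = 'C(N, k) * k ^_ w)%N.
Proof.
elim: w N k => [|w IHw] [|N] [|k] //= lt_wk; rewrite ?subn0 ?ffactn0 //.
  by rewrite !bin0n ffact0n muln0 mul0n.
by rewrite !subSS !ffactSS mulnCA IHw // mulnA mul_bin_diag -mulnA mulnCA.
Qed.

(** Adding [W] is a bijection from the subsets of [U :\: W] of size [k - #|W|] onto the sets
    counted. The product form, free of division, also covers [k < #|W|], where both sides vanish. *)
Lemma card_draws_superset (T : finType) (U W : {set T}) (k : nat) :
  W \subset U ->
  (#|[set S : {set T} | [&& S \subset U, #|S| == k & W \subset S]]| * #|U| ^_ #|W|
   = 'C(#|U|, k) * k ^_ #|W|)%N.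
Proof.
move=> sWU; have [lekW|ltkW] := leqP #|W| k; last first.
  rewrite (ffact_small ltkW) muln0; set A := [set S | _].
  suff -> : A = set0 by rewrite cards0.
  apply/setP=> S; rewrite !inE; apply/negP=> /and3P[_ /eqP cS /subset_leq_card].
  by rewrite cS leqNgt ltkW.
rewrite -bin_sub_ffact //; congr (_ * _)%N.
rewrite -[X in 'C(X, _)](_ : #|U :\: W| = _); last first.
  by rewrite cardsD (setIidPr sWU).
rewrite -cards_draws -[RHS](card_in_imset (f := fun A : {set T} => W :|: A)); last first.
  move=> A B; rewrite !inE !subsetD => /andP[/andP[_ dA] _] /andP[/andP[_ dB] _] eAB.
  have /(congr1 (fun S => S :\: W)) := eAB.
  by rewrite /= !setDUl setDv !set0U (setDidPl dA) (setDidPl dB).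
apply: eq_card => S; rewrite inE; apply/and3P/imsetP => [[sSU /eqP cS sWS]|[A]].
  exists (S :\: W); last by rewrite -{1}(setID S W) (setIidPr sWS).
  by rewrite inE setSD // cardsD (setIidPr sWS) cS eqxx.
rewrite inE subsetD => /andP[/andP[sAU dAW] /eqP cA] ->.
rewrite subUset sWU sAU subsetUl cardsU disjoint_setI0 1?disjoint_sym //.
by rewrite cards0 subn0 cA subnKC.
Qed.

(** * Inclusion-exclusion for indicators *)

Lemma prod_natr_bool (R : comNzRingType) (I : finType) (A P : pred I) :
  \prod_(i in A) (P i)%:R = [forall i in A, P i]%:R :> R.
Proof.
have [/forall_inP allP|] := boolP [forall i in A, P i].
  by rewrite big1 // => i /allP ->.
rewrite negb_forall_in => /exists_inP[i Ai /negbTE nPi].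
by rewrite (bigD1 i) //= nPi mul0r.
Qed.

(** Inclusion-exclusion for one fixed [S]: expand the product of [1 - [B \subset S]] over [B] in
    [P]. All members of [J] lie in [S] exactly when their union does, so each term depends on [J]
    only through its size and its cover. *)
Lemma inclusion_exclusion_subset (R : comNzRingType) (T : finType)
    (P : {set {set T}}) (S : {set T}) :
  [forall B in P, ~~ (B \subset S)]%:R
    = \sum_(J in powerset P) (-1) ^+ #|J| * (cover J \subset S)%:R :> R.
Proof.
(* The product runs over all sets so that [bigA_distr] applies; factors outside [P] equal 1. *)
transitivity (\prod_B (- ((B \in P) && (B \subset S))%:R + 1 : R)).
  rewrite -[[forall B in P, _]]
    (_ : [forall B in predT, (B \in P) ==> ~~ (B \subset S)] = _).
    rewrite -prod_natr_bool; apply: eq_bigr => B _.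
    by case: (B \in P); case: (B \subset S); rewrite /= ?addNr ?oppr0 ?add0r.
  by apply: eq_forallb => B.
rewrite bigA_distr [RHS]big_mkcond /=; apply: eq_bigr => J _.
rewrite -big_mkcond /= prodrN prod_natr_bool inE.
have -> : [forall B in J, (B \in P) && (B \subset S)]
          = (J \subset P) && (cover J \subset S).
  apply/forall_inP/andP=> [sJ|[/subsetP sJP /bigcupsP sJS] B BJ].
    split; first by apply/subsetP=> B /sJ/andP[].
    by apply/bigcupsP=> B /sJ/andP[].
  by rewrite sJP // sJS.
by case: (J \subset P) => //=; rewrite mulr0.
Qed.

Lemma sum_powerset_card (R : nzRingType) (T : finType) (P : {set T}) (f : nat -> R) :
  \sum_(J in powerset P) f #|J| = \sum_(0 <= i < #|P|.+1) 'C(#|P|, i)%:R * f i.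
Proof.
(* Group the subsets by size; [inord] loses nothing, as sizes are at most [#|P|]. *)
rewrite (partition_big (fun J : {set T} => inord #|J| : 'I_(#|P|.+1)) predT) //=.
rewrite big_mkord; apply: eq_bigr => i _.
rewrite -cards_draws mulr_natl -sumr_const.
apply: congr_big => // J; rewrite !inE.
  have [sJP|//] /= := boolP (J \subset P).
  by rewrite -val_eqE /= inordK // ltnS subset_leq_card.
by move=> /andP[sJP /eqP <-]; rewrite inordK // ltnS subset_leq_card //.
Qed.

(** * Uniform probabilities and random [k]-subsets *)

Lemma uniform_prob_sum (T : finType) (Omega : {set T}) (E : pred T) :
  uniform_prob Omega E = (\sum_(x in Omega) (E x)%:R) / #|Omega|%:R.
Proof.
rewrite /uniform_prob -sum1_card natr_sum big_mkcond /=; congr (_ / _).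
rewrite [RHS]big_mkcond; apply: eq_bigr => x _.
by rewrite inE; case: (x \in Omega); case: (E x).
Qed.

Lemma le_uniform_prob (T : finType) (Omega : {set T}) (E F : pred T) :
  {in Omega, subpred E F} -> uniform_prob Omega E <= uniform_prob Omega F.
Proof.
move=> sEF; rewrite ler_wpM2r ?invr_ge0 ?ler0n // ler_nat subset_leq_card //.
by apply/subsetP=> x; rewrite !inE => /andP[Ox Ex]; rewrite Ox sEF.
Qed.

Lemma uniform_prob_exists (T I : finType) (Omega : {set T}) (A : {pred I})
    (E : I -> pred T) :
  uniform_prob Omega (fun x => [exists i in A, E i x])
    <= \sum_(i in A) uniform_prob Omega (E i).
Proof.
rewrite (eq_bigr _ (fun i _ => uniform_prob_sum Omega (E i))) uniform_prob_sum.
rewrite -mulr_suml ler_wpM2r ?invr_ge0 ?ler0n // exchange_big /= ler_sum // => x _.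
have [/exists_inP[i Ai Eix]|_] := boolP [exists i in A, E i x]; last first.
  by rewrite sumr_ge0 // => i _; rewrite ler0n.
by rewrite (bigD1 i) //= Eix lerDl sumr_ge0 // => j _; rewrite ler0n.
Qed.

Lemma uniform_prob_superset (T : finType) (U W : {set T}) (k : nat) :
  W \subset U -> (k <= #|U|)%N ->
  uniform_prob [set S : {set T} | S \subset U & #|S| == k] (fun S => W \subset S)
    = (k ^_ #|W|)%:R / (#|U| ^_ #|W|)%:R.
Proof.
(* Both denominators are positive because [k] and [#|W|] are at most [#|U|]; cross-multiplying
   leaves the count of supersets. *)
move=> sWU lekU; apply/eqP; rewrite eqr_div ?pnatr_eq0 -?lt0n; last first.
- by rewrite ffact_gt0 subset_leq_card.
- by rewrite cards_draws bin_gt0.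
rewrite -!natrM eqr_nat cards_draws [X in _ == X]mulnC -card_draws_superset //.
by apply/eqP; congr (_ * _)%N; apply: eq_card => S; rewrite !inE andbA.
Qed.

(** Average the pointwise inclusion-exclusion over [S]. Disjointness of the pairs gives [cover J]
    exactly [2 * #|J|] elements, so the terms can be grouped by [#|J|]. The argument [#|U|.+1]
    matches the [n - 1] inside [pfun]. *)
Lemma uniform_prob_avoid_pairs (T : finType) (U : {set T}) (P : {set {set T}})
    (k : nat) :
  trivIset P -> cover P \subset U -> {in P, forall B : {set T}, #|B| = 2} ->
  (k <= #|U|)%N ->
  uniform_prob [set S : {set T} | S \subset U & #|S| == k]
    (fun S => [forall B in P, ~~ (B \subset S)]) = pfun #|U|.+1 k #|P|.
Proof.
move=> tiP sPU cardP lekU; rewrite uniform_prob_sum.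
under eq_bigr => S _ do rewrite inclusion_exclusion_subset.
rewrite exchange_big mulr_suml /=.
rewrite (eq_bigr (fun J : {set {set T}} =>
    (-1) ^+ #|J| * ((k ^_ (2 * #|J|))%:R / (#|U| ^_ (2 * #|J|))%:R))) => [|J].
  rewrite (sum_powerset_card P
    (fun i => (-1) ^+ i * ((k ^_ (2 * i))%:R / (#|U| ^_ (2 * i))%:R))).
  by rewrite /pfun subn1 /=; apply: eq_bigr => i _; rewrite mulrA [_ * (-1) ^+ i]mulrC.
rewrite inE => sJP; have sJU : cover J \subset U.
  apply: subset_trans sPU; apply/bigcupsP=> B BJ.
  by rewrite (bigcup_sup B) ?(subsetP sJP).
have <- : #|cover J| = (2 * #|J|)%N.
  rewrite -(eqP (trivIsetS sJP tiP)) mulnC -sum_nat_const.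
  by apply: eq_bigr => B /(subsetP sJP); exact: cardP.
by rewrite -mulr_sumr -mulrA -uniform_prob_sum uniform_prob_superset.
Qed.

(** * Distance and diameter as bounded searches *)

Lemma le_enat_least (P : pred nat) (m : nat) :
  le_enat (least P) m = [exists l : 'I_m.+1, P l].
Proof.
rewrite /least; case: boolp.pselect => [exP|nexP] /=; last first.
  by apply/esym/existsP=> -[l Pl]; apply: nexP; exists l.
case: ex_minnP => l Pl minl; apply/idP/existsP => [lelm|[j /minl lelj]].
  by exists (Ordinal (lelm : l < m.+1)%N).
exact: leq_trans lelj (ltn_ord j).
Qed.

Lemma le_enat_diameter (T : finType) (arc : rel T) (m : nat) :
  le_enat (diameter arc) m
    = [forall x, forall y, [exists l : 'I_m.+1, has_dipath arc x y l]].
Proof.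
rewrite le_enat_least; apply/existsP/'forall_forallP => [[l le_l] x y|le_m].
  have /forallP/(_ y) := forallP le_l x; rewrite le_enat_least.
  case/existsP=> j xy_j; apply/existsP.
  by exists (widen_ord (ltn_ord l : (l.+1 <= m.+1)%N) j).
by exists ord_max; apply/'forall_forallP=> x y; rewrite le_enat_least.
Qed.

(** Paths must have distinct vertices, yet no such condition remains on the right: if [x = y] the
    empty path serves, and otherwise irreflexivity keeps a midpoint away from both ends. *)
Lemma has_dipath_le2 (T : finType) (arc : rel T) (x y : T) : irreflexive arc ->
  [exists l : 'I_3, has_dipath arc x y l]
    = [|| x == y, arc x y | [exists z, arc x z && arc z y]].
Proof.
move=> irr; apply/existsP/or3P=> [[[[|[|[|//]]] ?] /existsP[p]]|[/eqP<-|xy|]].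
- by rewrite tuple0 => /and3P[_ _ ?]; constructor 1.
- case/tupleP: p => z p; rewrite tuple0 /= andbT => /and3P[? _ /eqP<-].
  by constructor 2.
- case/tupleP: p => z p; case/tupleP: p => t p; rewrite tuple0 /= andbT.
  move=> /and3P[/andP[xz zt] _ /eqP<-].
  by constructor 3; apply/existsP; exists z; rewrite xz.
- by exists ord0; apply/existsP; exists [tuple]; rewrite /= eqxx.
- have [<-|nxy] := eqVneq x y.
    by exists ord0; apply/existsP; exists [tuple]; rewrite /= eqxx.
  exists (inord 1); rewrite inordK //; apply/existsP; exists [tuple y].
  by rewrite /= xy inE nxy eqxx.
move=> /existsP[z /andP[xz zy]]; have [<-|nxy] := eqVneq x y.
  by exists ord0; apply/existsP; exists [tuple]; rewrite /= eqxx.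
exists (inord 2); rewrite inordK //; apply/existsP; exists [tuple z; y].
rewrite /= xz zy !inE negb_or nxy eqxx !andbT /=.
by apply/andP; split; [apply: contraTneq xz | apply: contraTneq zy] => ->; rewrite irr.
Qed.

(** * Diameter 2 in Cayley digraphs *)

Lemma cayleyE (gT : finGroupType) (S : {set gT}) (g h : gT) :
  cayley S g h = ((g^-1 * h)%g \in S).
Proof.
apply/exists_inP/idP=> [[s Ss /eqP->]|Sgh]; first by rewrite mulKg.
by exists (g^-1 * h)%g => //; rewrite mulKVg.
Qed.

(** By left translation, reachability of [y] from [x] depends only on [x^-1 * y], so it suffices to
    start at the identity. *)
Lemma cayley_diameter_le2 (gT : finGroupType) (S : {set gT}) : 1%g \notin S ->
  le_enat (diameter (cayley S)) 2
    = [forall z in [set: gT]^#%g, (z \in S) || (z \in S * S)%g].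
Proof.
move=> S1; have irr : irreflexive (cayley S).
  by move=> x; rewrite cayleyE mulVg (negbTE S1).
have dist2 x y : [exists l : 'I_3, has_dipath (cayley S) x y l]
    = [|| (x^-1 * y == 1)%g, (x^-1 * y)%g \in S | (x^-1 * y)%g \in (S * S)%g].
  rewrite has_dipath_le2 // cayleyE -eq_mulVg1; congr [|| _, _ | _].
  apply/existsP/mulsgP=> [[z]|[s t Ss St xy]].
    rewrite !cayleyE => /andP[Sxz Szy].
    by exists (x^-1 * z)%g (z^-1 * y)%g; rewrite // mulgA mulgK.
  exists (x * s)%g; rewrite !cayleyE mulKg Ss invMg -mulgA xy mulKg.
  exact: St.
rewrite le_enat_diameter; apply/'forall_forallP/forall_inP => [le2 z|le2 x y].
  by rewrite !inE andbT => /negPf nz; have := le2 1%g z; rewrite dist2 invg1 mul1g nz.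
rewrite dist2; have [//|nz] := eqVneq (x^-1 * y)%g 1%g.
by rewrite le2 // !inE nz.
Qed.

(** * Products of two elements in an elementary abelian 2-group *)

(** Every element is its own inverse, so [z = s * t] means [t = z * s]: the factors form the coset
    [[set s; z * s]]. *)
Lemma mem_mulgg_abelem2 (gT : finGroupType) (S : {set gT}) (z : gT) :
  (2.-abelem [set: gT])%g -> z != 1%g -> 1%g \notin S ->
  (z \in S * S)%g
    = [exists B in (rcosets <[z]> [set: gT] :\ <[z]>%g)%g, B \subset S].
Proof.
move=> abelG nz S1; have oz := abelem_order_p abelG (in_setT z) nz.
have [_ expG] := abelemP (isT : prime 2) abelG; have cGG := abelem_abelian abelG.
have inv (x : gT) : (x^-1 = x)%g by apply/eqP; rewrite eq_invg_mul -expg2 expG ?inE.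
have comm (x y : gT) : (x * y = y * x)%g by apply: (centsP cGG); rewrite inE.
have cosetE (s : gT) : (<[z]> :* s = [set s; z * s])%g.
  apply/setP=> x; rewrite mem_rcoset cycle2g // !inE.
  by rewrite !(can2_eq (mulgKV s) (mulgK s)) mul1g.
apply/mulsgP/exists_inP=> [[s t Ss St zst]|[B]].
  exists (<[z]> :* s)%g; last first.
    rewrite cosetE subUset !sub1set Ss /= zst (comm s) -mulgA -{2}(inv s).
    by rewrite mulgV mulg1.
  apply/setD1P; split; last by apply/rcosetsP; exists s.
  (* If the coset were [<[z]>], then [s = 1] or [s = z]; the latter forces [t = 1]. Either way [S]
     would contain 1. *)
  apply: contraNneq S1 => /(congr1 (fun A : {set gT} => s \in A)).
  rewrite rcoset_refl cycle2g // !inE => /esym/orP[]/eqP sz; first by rewrite -sz.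
  by move: zst; rewrite -sz -{1}(mulg1 s) => /mulgI->.
rewrite !inE => /andP[nB /rcosetsP[s _ defB]]; rewrite defB cosetE.
rewrite subUset !sub1set => /andP[Ss Szs]; exists (z * s)%g s => //.
by rewrite -mulgA -{2}(inv s) mulgV mulg1.
Qed.

Lemma connection_sets_not1 (gT : finGroupType) (k : nat) (S : {set gT}) :
  S \in connection_sets gT k -> 1%g \notin S.
Proof. by rewrite inE subsetD1 => /andP[/andP[]]. Qed.

Lemma cardsT1 (gT : finGroupType) : #|[set: gT]^#%g| = #|[set: gT]|.-1.
Proof. by rewrite (cardsD1 1%g [set: gT]) in_setT. Qed.

Lemma uniform_prob_notin_mulgg (gT : finGroupType) (k : nat) (z : gT) :
  (2.-abelem [set: gT])%g -> z != 1%g -> (k <= #|[set: gT]|.-1)%N ->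
  uniform_prob (connection_sets gT k) (fun S => z \notin (S * S)%g)
    = pfun #|[set: gT]| k ((#|[set: gT]| - 2) %/ 2).
Proof.
move=> abelG nz lek; have oz := abelem_order_p abelG (in_setT z) nz.
set P := (rcosets <[z]> [set: gT] :\ <[z]>%g)%g.
have partG := rcosets_partition (subsetT <[z]>%G).
have tiP : trivIset P by apply: trivIsetS (partition_trivIset partG); exact: subsetDl.
have cardR : {in rcosets <[z]> [set: gT], forall B : {set gT}, #|B| = 2}.
  by move=> _ /rcosetsP[s _ ->]; rewrite card_rcoset -orderE.
have cardP : {in P, forall B : {set gT}, #|B| = 2} by move=> B /setD1P[_ /cardR].
(* The only coset containing 1 is [<[z]>], which [P] leaves out. *)
have coverP : cover P \subset [set: gT]^#%g.
  rewrite subsetD1 subsetT; apply/bigcupP=> -[B /setD1P[nB /rcosetsP[s _ defB]]].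
  by rewrite defB => /rcoset_eqP; rewrite mulg1 -defB => eB; rewrite eB eqxx in nB.
(* The cosets in [P] together with [<[z]>] split the group into pairs, so its order is
   [(1 + #|P|) * 2]. *)
have sizeP : #|P| = ((#|[set: gT]| - 2) %/ 2)%N.
  rewrite (card_uniform_partition cardR partG) (cardsD1 <[z]>%g (rcosets _ _)) -/P.
  have -> : <[z]>%g \in rcosets <[z]> [set: gT].
    by apply/rcosetsP; exists 1%g; rewrite ?inE ?mulg1.
  by rewrite mulnDl mul1n addKn mulnK.
have := uniform_prob_avoid_pairs tiP coverP cardP; rewrite cardsT1 => /(_ k lek).
rewrite prednK ?cardG_gt0 // sizeP => <-.
rewrite !uniform_prob_sum; congr (_ / _); apply: eq_bigr => S OS.
rewrite mem_mulgg_abelem2 ?(connection_sets_not1 OS) //.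
by rewrite negb_exists_in.
Qed.

Theorem theorem3p4 (gT : finGroupType) (d n k : nat)
    (abelG : (2.-abelem [set: gT])%g)
    (cardG : #|[set: gT]| = n)
    (def_n : n = (2 ^ d)%N)
    (k_range : (1 <= k <= n - 1)%N) :
  pfun n k ((n - 2) %/ 2) - k%:R / (n - 1)%:R
    <= uniform_prob (connection_sets gT k)
         (fun S => ~~ le_enat (diameter (cayley S)) 2)
    <= (n - 1)%:R * pfun n k ((n - 2) %/ 2).
Proof.
have /andP[k_gt0 lekn] := k_range.
have cardU : #|[set: gT]^#%g| = (n - 1)%N by rewrite cardsT1 cardG subn1.
have probP z : z \in [set: gT]^#%g ->
    uniform_prob (connection_sets gT k) (fun S => z \notin (S * S)%g)
      = pfun n k ((n - 2) %/ 2).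
  move=> /setD1P[nz _].
  by rewrite uniform_prob_notin_mulgg ?cardG // -subn1.
have farE (S : {set gT}) : S \in connection_sets gT k ->
    ~~ le_enat (diameter (cayley S)) 2
      = [exists z in [set: gT]^#%g, (z \notin S) && (z \notin S * S)%g].
  move=> /connection_sets_not1 S1; rewrite cayley_diameter_le2 // negb_forall_in.
  by apply: eq_existsb => z; rewrite negb_or.
apply/andP; split.
  (* A nonidentity [z] exists because [1 <= k <= n - 1]. *)
  have [z Uz] : exists z, z \in [set: gT]^#%g.
    by apply/card_gt0P; rewrite cardU (leq_trans k_gt0).
  rewrite -(probP z Uz) lerBlDr.
  have <- : uniform_prob (connection_sets gT k) (fun S : {set gT} => [set z] \subset S)
            = k%:R / (n - 1)%:R.
    by rewrite uniform_prob_superset ?sub1set ?cardU // cards1 !ffactn1.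
  (* After moving [k / (n - 1)] to the right, the bound is checked for each [S]: if [z] is not in
     [S * S], then the diameter exceeds 2 or [z] is in [S]. *)
  rewrite !uniform_prob_sum -mulrDl ler_wpM2r ?invr_ge0 ?ler0n // -big_split.
  apply: ler_sum => S OS; rewrite farE // sub1set /= -natrD ler_nat.
  case zSS: (z \in (S * S)%g) => //; case zS: (z \in S); first by rewrite addn1.
  have -> // : [exists z in [set: gT]^#%g, (z \notin S) && (z \notin S * S)%g].
  by apply/exists_inP; exists z; rewrite ?zS ?zSS.
(* Union bound after dropping the condition [z \notin S]; the [n - 1] summands are all equal by
   [probP]. *)
apply: (@le_trans _ _ (\sum_(z in [set: gT]^#%g)
    uniform_prob (connection_sets gT k) (fun S => z \notin (S * S)%g))).
  apply: le_trans (uniform_prob_exists _ _ _); apply: le_uniform_prob => S OS.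
  rewrite farE // => /exists_inP[z Uz /andP[_ zSS]].
  by apply/exists_inP; exists z.
by rewrite (eq_bigr _ probP) sumr_const cardU mulr_natl.
Qed.
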